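(* For each integer $k\geq 1$ let $p=p_k$ be a real number with $0\leq p_k\leq 2^{-(k+1)}$, and suppose the limit $c=\lim_{k\to\infty}\frac{p_k}{2^{-(k+1)}}\in[0,1]$ exists. Let $$b_{\mathrm{L}}=\begin{cases}\frac{3-\sqrt{1+8c}}{2}\log_2 e-2c\log_2\left(\frac{1+4c+\sqrt{1+8c}}{8c}\right) & c>0,\\ \log_2 e & c=0.\end{cases}$$ Then $$1-C_{k,p_k}\geq \frac{b_{\mathrm{L}}}{2^{k+2}}(1+o(1)),$$ where $o(1)$ denotes a function of $k$ tending to $0$ as $k\to\infty$.
   Context: For finite words $\tau,\omega$ over $\{0,1\}$ with $|\tau|\leq|\omega|$, $T(\tau,\omega)=\frac{1}{|\omega|-|\tau|+1}\,\#\{0\leq i\leq |\omega|-|\tau| : \omega_i\omega_{i+1}\cdots\omega_{i+|\tau|-1}=\tau\}$ is the frequency of $\tau$ as a (contiguous) subword of $\omega$; if $|\tau|>|\omega|$ then $T(\tau,\omega)=0$. Let $1^{k+1}$ denote the word of $k+1$ consecutive ones. The $(0,k,p)$-RLL semiconstrained system is the set of all finite binary words $\omega$ with $T(1^{k+1},\omega)\leq p$. Let $\mathcal{B}_n=\{\omega\in\{0,1\}^n : T(1^{k+1},\omega)\leq p\}$. Its capacity is $C_{k,p}=\limsup_{n\to\infty}\frac1n\log_2|\mathcal{B}_n|$. *)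

(* Defs.v *)
(* The letters 0 and 1 are [false] and [true]. *)
From mathcomp Require Import all_boot all_order all_algebra.
From mathcomp Require Import all_classical all_reals all_analysis.
Import Order.TTheory GRing.Theory Num.Theory.
Import numFieldNormedType.Exports.

Set Implicit Arguments.
Unset Strict Implicit.
Unset Printing Implicit Defensive.

Local Open Scope ring_scope.

Definition log2 {R : realType} (x : R) : R := ln x / ln 2.

Definition freq (R : realType) (tau w : seq bool) : R :=
  if (size tau <= size w)%N then
    #|[pred i : 'I_(size w - size tau).+1 |
        take (size tau) (drop i w) == tau]|%:R
      / ((size w - size tau).+1)%:R
  else 0.

Definition in_RLL {R : realType} (k : nat) (p : R) (w : seq bool) : bool :=
  freq R (nseq k.+1 true) w <= p.

Definition RLL_words {R : realType} (k : nat) (p : R) (n : nat) :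
    {set n.-tuple bool} :=
  [set w : n.-tuple bool | in_RLL k p w]%SET.

(* The sequence takes values in [0, 1] when 0 <= p, so the real-valued
   [limn_sup] is the limsup; its term at n = 0 (where 0^-1 = 0) is
   irrelevant. *)
Definition capacity {R : realType} (k : nat) (p : R) : R :=
  limn_sup (fun n : nat => n%:R^-1 * log2 (#|RLL_words k p n|%:R : R)).

Definition bL {R : realType} (c : R) : R :=
  if 0 < c then
    (3 - Num.sqrt (1 + 8 * c)) / 2 * log2 (expR 1)
    - 2 * c * log2 ((1 + 4 * c + Num.sqrt (1 + 8 * c)) / (8 * c))
  else log2 (expR 1).

(* Main.v *)
(* Chernoff's method with a transfer matrix. Let occ count the occurrences of
   1^(k+1). For 0 < z <= 1 the number of w of length n with occ w <= p n is at
   most z^(- p n) * sum_w z^(occ w), and the sum is O(mu^n) as soon as the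
   transfer matrix A on the length of the leading run of ones, capped at k, has
   a positive vector v with A v <= mu v. Solving the recursion for v shows that
   mu = 2 - 2^(-k) (1 - z) / (2 - z) works for every k, whence
   1 - C_(k,p) >= 2^(-k-2) (2 (1 - z) / (2 - z) log2 e + 2 c log2 z) with
   c = p 2^(k+1). The right-hand side is maximal when z = c (2 - z)^2, and its
   maximum is b_L / 2^(k+2) (a supremum, as z tends to 0, when c = 0). *)
Require Import Defs.
From mathcomp Require Import all_boot all_order all_algebra.
From mathcomp Require Import all_classical all_reals all_analysis.
From mathcomp Require Import ring lra zify.
Import Order.TTheory GRing.Theory Num.Theory.
Import numFieldNormedType.Exports.

Set Implicit Arguments.
Unset Strict Implicit.
Unset Printing Implicit Defensive.

Local Open Scope classical_set_scope.
Local Open Scope ring_scope.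

(** * Occurrence counts *)

Fixpoint occ (tau w : seq bool) : nat :=
  if w is _ :: w' then ((take (size tau) w == tau) + occ tau w')%N else 0%N.

Lemma occ_count (tau w : seq bool) :
  occ tau w =
  count (fun i => take (size tau) (drop i w) == tau) (iota 0 (size w)).
Proof.
elim: w => //= b w ->; congr (_ + _)%N.
by rewrite -[1%N]addn0 iotaDl count_map.
Qed.

(** The frequency divides by the number of windows, which is at most [size w] because [tau] is
    nonempty. *)
Lemma occ_le_freq (R : realType) (tau w : seq bool) :
  (0 < size tau)%N -> (occ tau w)%:R <= freq R tau w * (size w)%:R.
Proof.
move=> tau0; set P := fun i => take (size tau) (drop i w) == tau.
have zero (s : seq nat) :
    {in s, forall i, (size w < i + size tau)%N} -> count P s = 0%N.
  move=> Hs; apply/eqP; rewrite -leqn0 leqNgt -has_count; apply/hasPn => /= i.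
  move=> /Hs lt_i; apply/eqP => /(congr1 (@size bool)).
  by rewrite size_take size_drop; case: ltnP; clear Hs P; lia.
rewrite occ_count -/P /freq; case: leqP => [le_w|lt_w]; last first.
  by rewrite zero ?mul0r// => i _; lia.
set m := (size w - size tau)%N.
(* The last [(size tau).-1] positions leave too few letters for an occurrence. *)
have -> : size w = (m.+1 + (size tau).-1)%N by lia.
rewrite iotaD count_cat [X in (_ + X)%N]zero ?addn0; last first.
  by move=> i; rewrite mem_iota; lia.
have -> : #|[pred i : 'I_m.+1 | P i]| = count P (iota 0 m.+1).
  rewrite -sum1_card -(big_mkord P (fun=> 1%N)) /index_iota subn0.
  by rewrite sum1_count.
rewrite -mulrA ler_peMr// mulrC ler_pdivlMr ?ltr0n// mul1r ler_nat; lia.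
Qed.

(** * The transfer matrix and its vector *)

Lemma take_eq_nseq (n : nat) (w : seq bool) :
  (take n w == nseq n true) = (n <= find negb w)%N.
Proof. by elim: n w => [|n IHn] [|[] w] //=; rewrite eqseq_cons IHn. Qed.

(* [weight mu z m] is the entry of v at a run that lacks m ones to length k. *)
Fixpoint weight {R : fieldType} (mu z : R) (m : nat) : R :=
  if m is m'.+1 then (1 + weight mu z m') / mu else (mu - z)^-1.

(** The affine recursion has fixed point [1 / (mu - 1)], and the deviation from it shrinks by a
    factor [mu] at each step. *)
Lemma weight_closed (R : fieldType) (mu z : R) (m : nat) :
  mu != 0 -> mu - z != 0 ->
  weight mu z m * (mu - 1) = 1 - (1 - z) / (mu - z) / mu ^+ m.
Proof.
move=> mu0 muz; elim: m => [|m IHm] /=.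
  by rewrite expr0; field; rewrite oner_neq0.
have muX : mu ^+ m != 0 by rewrite expf_neq0.
by rewrite mulrAC mulrDl IHm exprS; field; rewrite mu0 muX muz.
Qed.

Lemma weight_ge (R : realFieldType) (mu z : R) (m : nat) :
  0 < z <= 1 -> 1 < mu <= 2 -> 2^-1 <= weight mu z m.
Proof.
move=> /andP[z0 z1] /andP[mu1 mu2]; elim: m => [|m IHm] /=.
  by rewrite lef_pV2 ?posrE; lra.
by rewrite ler_pdivlMr; lra.
Qed.

(** [find negb w] is the leading run of ones; truncated subtraction caps it at [k]. *)
Definition potential {R : fieldType} (mu z : R) (k : nat) (w : seq bool) : R :=
  z ^+ occ (nseq k.+1 true) w * weight mu z (k - find negb w).

(** This is A v <= mu v. Prepending a zero leads to [weight mu z k]; with 1 in its place, the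
    recursion for [weight] gives equality in both cases. *)
Lemma potential_cons (R : realFieldType) (mu z : R) (k : nat) (w : seq bool) :
  0 < z <= 1 -> 1 < mu <= 2 -> weight mu z k <= 1 ->
  potential mu z k (true :: w) + potential mu z k (false :: w)
    <= mu * potential mu z k w.
Proof.
move=> /andP[z0 z1] /andP[mu1 mu2] uk1.
rewrite /potential /= subn0 eqseq_cons size_nseq take_eq_nseq /=.
set e := z ^+ occ _ _; have e0 : 0 <= e by rewrite exprn_ge0// ltW.
rewrite exprD -/e [leRHS]mulrCA [z ^+ _ * e]mulrC -mulrA -mulrDr.
(* From a run of at least [k], a further one completes an occurrence, at the cost of a factor
   [z]. *)
rewrite ler_wpM2l//; case: leqP => [le_k|lt_k].
  have -> : (k - find negb w = 0)%N by lia.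
  have -> : (k - (find negb w).+1 = 0)%N by lia.
  rewrite expr1 /=.
  have -> : mu * (mu - z)^-1 = 1 + z * (mu - z)^-1 by field; lra.
  lra.
have -> : (k - find negb w = (k - (find negb w).+1).+1)%N by lia.
by rewrite expr0 mul1r /= mulrC divfK; lra.
Qed.

Lemma big_tupleS (R : nmodType) (n : nat) (F : seq bool -> R) :
  \sum_(w : n.+1.-tuple bool) F w =
  \sum_(w : n.-tuple bool) (F (true :: w) + F (false :: w)).
Proof.
rewrite (reindex (fun x : bool * n.-tuple bool => [tuple of x.1 :: x.2])) /=.
  rewrite -(pair_big xpredT xpredT (fun b (w : n.-tuple bool) => F (b :: w))).
  by rewrite big_bool /= big_split.
exists (fun w => (thead w, [tuple of behead w])) => [[b w] _|w _] /=.
  by congr (_, _); apply: val_inj.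
by rewrite -tuple_eta.
Qed.

Lemma sum_potential_le (R : realFieldType) (mu z : R) (k n : nat) :
  0 < z <= 1 -> 1 < mu <= 2 -> weight mu z k <= 1 ->
  \sum_(w : n.-tuple bool) potential mu z k w <= mu ^+ n.
Proof.
move=> hz hmu uk1; elim: n => [|n IHn].
  rewrite (eq_bigr (fun=> weight mu z k)) => [|w _]; last first.
    by rewrite tuple0 /potential /= subn0 mul1r.
  by rewrite sumr_const card_tuple expn0.
rewrite big_tupleS exprS; apply: (@le_trans _ _
  (\sum_(w : n.-tuple bool) mu * potential mu z k w)).
  by apply: ler_sum => w _; exact: potential_cons.
by rewrite -mulr_sumr ler_wpM2l//; case/andP: hmu; lra.
Qed.

(** * Chernoff bound and capacity *)

(** For each counted word z^(p n) <= z^occ <= 2 [potential]; the factor 2 comes from [weight_ge]. *)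
Lemma card_RLL_words_le (R : realType) (mu z p : R) (k n : nat) :
  0 < z <= 1 -> 1 < mu <= 2 -> weight mu z k <= 1 ->
  #|RLL_words k p n|%:R * z `^ (p * n%:R) <= 2 * mu ^+ n.
Proof.
move=> hz hmu uk1; have /andP[z0 z1] := hz.
apply: (@le_trans _ _ (2 * \sum_(w : n.-tuple bool) potential mu z k w));
  last by rewrite ler_wpM2l// sum_potential_le.
rewrite mulr_sumr -[_%:R]/(1 *+ _) -sumr_const mulr_suml.
have pos w : 0 <= 2 * potential mu z k w.
  rewrite !mulr_ge0 ?exprn_ge0 ?(ltW z0)//.
  by apply: le_trans (weight_ge _ hz hmu); rewrite invr_ge0.
rewrite big_mkcond /=; apply: ler_sum => w _; case: ifP => //.
rewrite inE /in_RLL => wB; rewrite mul1r.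
have occ_le : (occ (nseq k.+1 true) w)%:R <= p * n%:R.
  have := @occ_le_freq R (nseq k.+1 true) w; rewrite size_nseq => /(_ isT).
  by move/le_trans; apply; rewrite size_tuple ler_wpM2r.
apply: (@le_trans _ _ (z ^+ occ (nseq k.+1 true) w)).
  by rewrite -powR_mulrn ?(ltW z0)// ger_powR.
rewrite mulrCA ler_peMr ?exprn_ge0 ?(ltW z0)//.
have := weight_ge (k - find negb w) hz hmu; lra.
Qed.

Lemma log2_card_RLL_words_le (R : realType) (mu z p : R) (k n : nat) :
  0 <= p -> 0 < z <= 1 -> 1 < mu <= 2 -> weight mu z k <= 1 ->
  log2 #|RLL_words k p n|%:R <= 1 + n%:R * (log2 mu - p * log2 z) :> R.
Proof.
move=> p0 hz hmu uk1; have /andP[z0 z1] := hz; have /andP[mu1 mu2] := hmu.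
have ln20 : 0 < ln 2 :> R by rewrite ln_gt0//; lra.
have lnmu : 0 <= ln mu by rewrite ln_ge0// ltW.
have lnz : ln z <= 0 by rewrite ln_le0.
rewrite /log2 ler_pdivrMr// mulrDl mul1r.
have -> : n%:R * (ln mu / ln 2 - p * (ln z / ln 2)) * ln 2 =
  n%:R * (ln mu - p * ln z) by field; lra.
(* By convention [ln 0 = 0], so here the right-hand side must be shown nonnegative. *)
have [->|card0] := posnP #|RLL_words k p n|.
  rewrite ln0// addr_ge0// ?(ltW ln20)// mulr_ge0// subr_ge0.
  by rewrite (le_trans _ lnmu)// mulr_ge0_le0.
have := @card_RLL_words_le R mu z p k n hz hmu uk1.
rewrite -ler_ln ?posrE ?mulr_gt0 ?powR_gt0 ?exprn_gt0 ?ltr0n//; try lra.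
rewrite !lnM ?posrE ?powR_gt0 ?exprn_gt0 ?ltr0n//; try lra.
rewrite ln_powR lnXn; last lra.
rewrite -mulr_natl; lra.
Qed.

(** The two bounds on the range make the real-valued tail suprema converge, so that their limit is
    not a default value. *)
Lemma limn_sup_le (R : realType) (u : R^nat) (a : R) :
  has_ubound (range u) -> has_lbound (range u) ->
  (\forall n \near \oo, u n <= a) -> limn_sup u <= a.
Proof.
move=> ubu lbu [N _ uN]; apply: limr_le.
  by apply: cvgP; exact: cvg_sups_inf.
exists N => // n /= Nn; apply: ge_sup; first by exists (u n); exists n => /=.
by move=> _ [m /= nm <-]; apply: uN => /=; exact: leq_trans nm.
Qed.

Lemma capacity_le (R : realType) (mu z p : R) (k : nat) :
  0 <= p -> 0 < z <= 1 -> 1 < mu <= 2 -> weight mu z k <= 1 ->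
  capacity k p <= log2 mu - p * log2 z.
Proof.
move=> p0 hz hmu uk1; set a := log2 mu - _; rewrite /capacity.
set u : R^nat := (X in limn_sup X).
have a0 : 0 <= a.
  have /andP[z0 z1] := hz; have /andP[mu1 mu2] := hmu.
  have ln20 : 0 < ln 2 :> R by rewrite ln_gt0//; lra.
  rewrite subr_ge0; apply: (@le_trans _ _ 0).
    rewrite mulr_ge0_le0// /log2 mulr_le0_ge0 ?ln_le0// invr_ge0 ltW//.
  by rewrite /log2 divr_ge0 ?ln_ge0 ?ltW//; lra.
have u_ge0 n : 0 <= u n.
  rewrite mulr_ge0 ?invr_ge0// /log2 divr_ge0//; last by rewrite ln_ge0//; lra.
  have [->|card0] := posnP #|RLL_words k p n|; first by rewrite ln0.
  by rewrite ln_ge0// ler1n.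
have u_le n : u n <= a + n%:R^-1.
  rewrite /u; have [->|n0] := posnP n; first by rewrite invr0 mul0r addr0.
  rewrite ler_pdivrMl ?ltr0n// mulrDr mulfV ?pnatr_eq0 ?lt0n_neq0// addrC.
  exact: log2_card_RLL_words_le.
have lbu : has_lbound (range u) by exists 0 => _ [n _ <-].
have ubu : has_ubound (range u).
  exists (a + 1) => _ [n _ <-]; apply: (le_trans (u_le n)).
  rewrite lerD2l; case: n => [|n]; first by rewrite invr0.
  by rewrite invf_le1 ?ltr0n// ler1n.
apply/ler_addgt0Pr => e e0; apply: limn_sup_le => //.
near=> n; apply: (le_trans (u_le n)); rewrite lerD2l.
have n0 : (0 < n)%N by near: n; exact: nbhs_infty_gt.
rewrite -[leRHS]invrK lef_pV2 ?posrE ?invr_gt0 ?ltr0n//.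
near: n; exact: nbhs_infty_ger.
Unshelve. all: by end_near. Qed.

Lemma one_sub_capacity_ge (R : realType) (z p : R) (k : nat) :
  0 <= p -> 0 < z <= 1 ->
  (1 - z) / (2 - z) / 2 ^+ k.+1 * log2 (expR 1) + p * log2 z
    <= 1 - capacity k p.
Proof.
move=> p0 hz; have /andP[z0 z1] := hz.
have ln20 : 0 < ln 2 :> R by rewrite ln_gt0//; lra.
set d := (1 - z) / (2 - z) / 2 ^+ k.+1.
have pow1 : 1 <= 2 ^+ k :> R by rewrite exprn_ege1//; lra.
have pow0 : 0 < 2 ^+ k :> R by lra.
have frac_le : (1 - z) / (2 - z) <= 2^-1 by rewrite ler_pdivrMr; lra.
have frac_ge : 0 <= (1 - z) / (2 - z) by rewrite divr_ge0; lra.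
have d0 : 0 <= d by rewrite divr_ge0// exprn_ge0.
have d4 : d <= 4^-1.
  rewrite ler_pdivrMr ?exprn_gt0// exprS; lra.
(* By [weight_closed], [weight mu z k <= 1] means (1 - z) / (mu - z) / mu^k >= 2 - mu = 2 d. As mu
   <= 2, the left side is at least its value with 2 for mu, which is exactly 2 d. *)
set mu := 2 * (1 - d).
have mu1 : 1 < mu by rewrite /mu; lra.
have mu2 : mu <= 2 by rewrite /mu; lra.
have hmu : 1 < mu <= 2 by rewrite mu1.
have wk : weight mu z k <= 1.
  rewrite -(@ler_pM2r _ (mu - 1)); last lra.
  rewrite weight_closed ?mul1r; [|lra|lra].
  have : (1 - z) / (2 - z) / 2 ^+ k <= (1 - z) / (mu - z) / mu ^+ k.
    rewrite ler_pM ?invr_ge0 ?(ltW pow0)//.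
      by rewrite ler_wpM2l ?lef_pV2 ?posrE; lra.
    rewrite lef_pV2 ?posrE ?exprn_gt0//; last lra.
    by rewrite lerXn2r// nnegrE; lra.
  have -> : (1 - z) / (2 - z) / 2 ^+ k = 2 * d.
    by rewrite /d exprS; field; rewrite gt_eqF//; lra.
  rewrite /mu; lra.
apply: (@le_trans _ _ (1 - (log2 mu - p * log2 z))); last first.
  by rewrite lerD2l lerN2; exact: capacity_le.
have : log2 mu <= 1 - d * log2 (expR 1).
  rewrite /log2 expRK ler_pdivrMr// mulrDl mul1r mulNr mul1r mulfVK ?gt_eqF//.
  rewrite lnM ?posrE; [|lra|lra].
  have := @le_ln1Dx R (- d); lra.
lra.
Qed.

(** * Optimization over [z] *)

Lemma bL_attained (R : realType) (c : R) : 0 < c <= 1 ->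
  exists2 z, 0 < z <= 1 &
    2 * ((1 - z) / (2 - z)) * log2 (expR 1) + 2 * c * log2 z = bL c.
Proof.
move=> /andP[c0 c1]; rewrite /bL c0; set s := Num.sqrt _.
have s2 : s * s = 1 + 8 * c by rewrite -expr2 sqr_sqrtr; lra.
have s0 : 0 <= s := sqrtr_ge0 _.
have s1 : 1 < s by nra.
have s3 : s <= 3 by nra.
(* In terms of s the critical point z = c (2 - z)^2 is 2 (s - 1) / (s + 1). *)
have cE : c = (s * s - 1) / 8 by lra.
have z0 : 0 < 2 * (s - 1) / (s + 1) by rewrite divr_gt0; lra.
exists (2 * (s - 1) / (s + 1)).
  by rewrite z0 ler_pdivrMr; lra.
(* The logarithm in [bL] is taken at 1 / z. *)
have -> : (1 + 4 * c + s) / (8 * c) = (2 * (s - 1) / (s + 1))^-1.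
  by rewrite cE; field; apply/and3P; split; nra.
rewrite /log2 lnV ?posrE// mulNr mulrN opprK; congr (_ * _ + _).
by field; lra.
Qed.

Lemma bL_approx (R : realType) (c e : R) : 0 <= c <= 1 -> 0 < e ->
  exists2 z, 0 < z <= 1 &
    bL c - e < 2 * ((1 - z) / (2 - z)) * log2 (expR 1) + 2 * c * log2 z.
Proof.
move=> /andP[c0 c1] e0; move: c0; rewrite le_eqVlt => /predU1P[<-|c0]; last first.
  have [|z hz <-] := @bL_attained R c; first by rewrite c0.
  by exists z => //; lra.
rewrite /bL ltxx; set L := log2 _.
have L0 : 0 < L by rewrite /L /log2 expRK divr_gt0// ln_gt0//; lra.
have zL : e / (e + L) * L < e by rewrite mulrAC ltr_pdivrMr; nra.
have z0 : 0 < e / (e + L) by rewrite divr_gt0; lra.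
have z1 : e / (e + L) <= 1 by rewrite ler_pdivrMr; lra.
(* Since 2 (1 - z) / (2 - z) >= 1 - z, the loss is at most z L, which this choice keeps below
   [e]. *)
exists (e / (e + L)); first by rewrite z0.
move: (e / _) zL z0 z1 => z zL z0 z1; rewrite mulr0 mul0r addr0.
have : (1 - z) / 2 <= (1 - z) / (2 - z) by rewrite ler_wpM2l ?lef_pV2 ?posrE; lra.
by nra.
Qed.

Theorem theorem28 (R : realType) (p : nat -> R) (c : R)
    (hp : forall k : nat, (1 <= k)%N -> 0 <= p k <= 2 ^- k.+1)
    (hc01 : 0 <= c <= 1)
    (hc : p k / 2 ^- k.+1 @[k --> \oo] --> c) :
  exists o : nat -> R,
    o k @[k --> \oo] --> (0 : R) /\
    forall k : nat, (1 <= k)%N ->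
      1 - capacity k (p k) >= bL c / 2 ^+ k.+2 * (1 + o k).
Proof.
have pow0 k : 0 < 2 ^+ k :> R by rewrite exprn_gt0//; lra.
(* Here 1 - C >= 0 suffices, which is the bound at z = 1. This covers c = 1, where [bL] vanishes. *)
have [b0|b0] := leP (bL c) 0.
  exists (fun=> 0); split=> [|k k1]; first exact: cvg_cst.
  have /andP[pk _] := hp k k1.
  have := @one_sub_capacity_ge R 1 (p k) k pk.
  rewrite ltr01 lexx subrr !mul0r /log2 ln1 mul0r mulr0 addr0 addr0 mulr1.
  by move=> /(_ isT); apply: le_trans; rewrite pmulr_lle0 ?invr_gt0.
pose X k := (1 - capacity k (p k)) * 2 ^+ k.+2.
(* [z] is fixed from the limit [c] before [k] grows; for fixed [z] the bound is continuous in p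
   2^(k+1). *)
have X_ge e : 0 < e -> \forall k \near \oo, bL c - e < X k.
  move=> e0; have [z hz gz] := bL_approx hc01 e0.
  have cvg_g : 2 * ((1 - z) / (2 - z)) * log2 (expR 1)
      + 2 * (p k / 2 ^- k.+1) * log2 z @[k --> \oo] -->
      2 * ((1 - z) / (2 - z)) * log2 (expR 1) + 2 * c * log2 z.
    apply: cvgD; first exact: cvg_cst.
    by apply: cvgMr_tmp; apply: cvgMl_tmp.
  near=> k.
  have k1 : (1 <= k)%N by near: k; exact: nbhs_infty_gt.
  have /andP[pk _] := hp k k1.
  apply: (@lt_le_trans _ _ (2 * ((1 - z) / (2 - z)) * log2 (expR 1)
      + 2 * (p k / 2 ^- k.+1) * log2 z)).
    by near: k; exact: (cvgr_gt _ cvg_g).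
  rewrite -ler_pdivrMr//; apply: le_trans (one_sub_capacity_ge k pk hz).
  rewrite le_eqVlt; apply/orP; left; apply/eqP.
  have z2 : 2 - z != 0 by rewrite gt_eqF//; case/andP: hz => *; lra.
  by rewrite !exprS invrK; field; rewrite z2 gt_eqF.
(* [X] is only bounded from below in the limit; cutting off at 0 forces convergence and keeps the
   inequality. *)
exists (fun k => Num.min 0 (X k / bL c - 1)); split=> [|k k1].
  apply/cvgrPdist_le => e e0.
  have := X_ge (bL c * e) (mulr_gt0 b0 e0).
  apply: filterS => k Xk.
  have Xb : 1 - e < X k / bL c by rewrite ltr_pdivlMr//; lra.
  by rewrite sub0r normrN ler_norml minEle; case: ifP => h; apply/andP; split; lra.
rewrite mulrAC ler_pdivrMr// -/(X k) mulrC -ler_pdivlMr//.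
by rewrite minEle; case: ifP => h; lra.
Unshelve. all: by end_near. Qed.
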